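(* Let $\Gamma$ be a quiver with vertices $1,\dots,n$, let $M$ be a representation of $\Gamma$ over a field $k$, and let $e=(e_1,\dots,e_n)$ be a nilpotent endomorphism of $M$. Let $\lambda^i\in\mathcal{P}$ be the type of $e_i$ for $1\le i\le n$, put $\lambda_*=(\lambda^1,\dots,\lambda^n)$, and let $r$ be the largest part among the partitions $\lambda^1,\dots,\lambda^n$. Then $M$ admits an $e$-compatible filtration by subrepresentations $M_{i,s}$ ($1\le i\le s\le r$), together with $M_{0,0}=0$, arranged in a single chain as follows: $$M_{i-1,i-1}\subseteq M_{i,r}\subseteq M_{i,r-1}\subseteq\cdots\subseteq M_{i,i}\qquad(i=1,2,\dots,r),\qquad M_{0,0}=0,\quad M_{r,r}=M,$$ such that: (1) for $1\le i\le r$ and $i\le s\le r-1$, $M_{i,s}/M_{i,s+1}\cong M_{1,s}/M_{1,s+1}$, with $\dim(M_{1,s}/M_{1,s+1})=\lambda_*^{(s)}$; (2) for $1\le i\le r$, $M_{i,r}/M_{i-1,i-1}\cong M_{1,r}$, with $\dim M_{1,r}=\lambda_*^{(r)}$.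
   Context: A quiver $\Gamma$ has vertex set $\{1,\dots,n\}$ and finitely many arrows (loops and multiple arrows allowed). A representation $M$ over $k$ assigns a finite-dimensional $k$-vector space $V_i$ to each vertex and a $k$-linear map $V_a:V_i\to V_j$ to each arrow $a:i\to j$; $\dim M=(\dim V_1,\dots,\dim V_n)\in\mathbb{N}^n$. A homomorphism is a family of linear maps between the vertex spaces commuting with all arrow maps. An endomorphism $e=(e_i)$ is nilpotent if all $e_i$ are nilpotent. $\mathcal{P}$ denotes the set of partitions of non-negative integers (including the empty partition). The type of a nilpotent linear map (matrix) is the partition formed by the sizes of its Jordan blocks. For a partition $\lambda$ and $k\ge1$, $m_\lambda^{(k)}$ is the number of parts of $\lambda$ equal to $k$, and for $\lambda_*=(\lambda^1,\dots,\lambda^n)\in\mathcal{P}^n$, $\lambda_*^{(k)}=(m_{\lambda^1}^{(k)},\dots,m_{\lambda^n}^{(k)})\in\mathbb{N}^n$. A filtration of subrepresentations $0=N_0\subseteq N_1\subseteq\cdots\subseteq N_t=M$ is $e$-compatible if $e(N_l)\subseteq N_{l-1}$ for $1\le l\le t$; here the filtration is the chain of all $M_{i,s}$ in the order $M_{0,0},M_{1,r},M_{1,r-1},\dots,M_{1,1},M_{2,r},\dots,M_{2,2},\dots,M_{r-1,r},M_{r-1,r-1},M_{r,r}$ (consecutive terms may coincide). If $M=0$, put $r=0$ and the statement is trivial. *)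

(* Defs.v *)
From HB Require Import structures.
From mathcomp Require Import all_boot all_order all_algebra.
From mathcomp Require Import generic_quotient.

Set Implicit Arguments.
Unset Strict Implicit.
Unset Printing Implicit Defensive.

Import GRing.Theory.

Local Open Scope ring_scope.
Local Open Scope quotient_scope.

Section QuotientSpace.
Variables (K : fieldType) (V : vectType K) (U : {vspace V}).

Definition quotv : Type := Quotient.quot (pred_of_vspace U : zmodClosed V).

HB.instance Definition _ := ZmodQuotient.on quotv.

Definition quotv_pi (x : V) : quotv := \pi_quotv x.
Definition quotv_repr (q : quotv) : V := repr q.

Lemma quotv_pi_eq x y : (quotv_pi x == quotv_pi y) = (x - y \in U).
Proof. by rewrite /quotv_pi piE. Qed.

Lemma quotv_reprK q : quotv_pi (quotv_repr q) = q.
Proof. exact: reprK. Qed.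

Lemma quotv_piD : {morph quotv_pi : x y / x + y}.
Proof. by move=> x y; rewrite /quotv_pi !piE. Qed.

Definition quotv_scale (a : K) (q : quotv) : quotv := quotv_pi (a *: quotv_repr q).

Lemma quotv_scale_pi a x : quotv_scale a (quotv_pi x) = quotv_pi (a *: x).
Proof.
apply/eqP; rewrite quotv_pi_eq -scalerBr rpredZ //.
by rewrite -quotv_pi_eq quotv_reprK.
Qed.

Fact quotv_scaleA a b q : quotv_scale a (quotv_scale b q) = quotv_scale (a * b) q.
Proof. by rewrite -(quotv_reprK q) !quotv_scale_pi scalerA. Qed.
Fact quotv_scale1 : left_id 1 quotv_scale.
Proof. by move=> q; rewrite -(quotv_reprK q) quotv_scale_pi scale1r. Qed.
Fact quotv_scaleDr : right_distributive quotv_scale +%R.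
Proof.
move=> a p q; rewrite -(quotv_reprK p) -(quotv_reprK q).
by rewrite -quotv_piD !quotv_scale_pi scalerDr quotv_piD.
Qed.
Fact quotv_scaleDl q : {morph quotv_scale^~ q : a b / a + b}.
Proof.
by move=> a b; rewrite -(quotv_reprK q) !quotv_scale_pi scalerDl quotv_piD.
Qed.

HB.instance Definition _ := GRing.Zmodule_isLmodule.Build K quotv
  quotv_scaleA quotv_scale1 quotv_scaleDr quotv_scaleDl.

Fact quotv_pi_is_linear : linear quotv_pi.
Proof. by move=> a x y; rewrite quotv_piD -quotv_scale_pi. Qed.
HB.instance Definition _ := GRing.isSemilinear.Build K V quotv _ quotv_pi
  (GRing.semilinear_linear quotv_pi_is_linear).

(* Coordinates of a class: those of its unique representative in U^C. *)
Let proj : 'End(V) := daddv_pi U^C U.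

Let complU : (U^C :&: U = 0)%VS.
Proof. by rewrite capvC capv_compl. Qed.

Let proj_sub x : x - proj x \in U.
Proof.
have xUU : x \in (U^C + U)%VS by rewrite addvC addv_complf memvf.
by rewrite -{1}(daddv_pi_add complU xUU) addrC addKr memv_pi.
Qed.

Let proj_eq x y : quotv_pi x = quotv_pi y -> proj x = proj y.
Proof.
move/eqP; rewrite quotv_pi_eq => xyU; apply/eqP; rewrite -subr_eq0 -linearB.
rewrite -memv0 -complU memv_cap memv_pi /=.
by rewrite -[proj _](subKr (x - y)) rpredB.
Qed.

Fact quotv_vect_iso : Vector.axiom (\dim U^C) quotv.
Proof.
have projC x : proj x \in (U^C)%VS by exact: memv_pi.
have pi_proj x : quotv_pi (proj x) = quotv_pi x.
  by apply/eqP; rewrite eq_sym quotv_pi_eq.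
exists (fun q => \row_i coord (vbasis U^C) i (proj (quotv_repr q))).
  move=> a p q; apply/rowP=> i; rewrite !mxE -linearP -linearP; congr (coord _ _ _).
  apply: proj_eq; rewrite quotv_reprK linearP.
  by rewrite /= !quotv_reprK.
exists (fun r : 'rV_(\dim U^C) => quotv_pi (\sum_i r 0 i *: (vbasis U^C)`_i)).
  move=> q /=; rewrite -[RHS]quotv_reprK -[RHS]pi_proj; congr quotv_pi.
  by rewrite [RHS](coord_vbasis (projC _)); apply: eq_bigr => i _; rewrite mxE.
move=> r; apply/rowP=> i; rewrite mxE; set x := \sum_i _.
have xC : x \in (U^C)%VS.
  by apply: rpred_sum => j _; rewrite rpredZ ?vbasis_mem ?memt_nth.
rewrite (proj_eq (quotv_reprK _)) daddv_pi_id //.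
by rewrite coord_sum_free ?(basis_free (vbasisP _)).
Qed.

HB.instance Definition _ := Lmodule_hasFinDim.Build K quotv quotv_vect_iso.

End QuotientSpace.

Section InducedMaps.
Variables (K : fieldType) (V W : vectType K) (f : 'Hom(V, W)).
Variables (A : {vspace V}) (B : {vspace W}).

(* Both maps below are meaningful only when f sends A into B. *)
Definition sub_lfun : 'Hom(subvs_of A, subvs_of B) :=
  linfun (vsproj B \o f \o vsval).

Definition quot_lfun : 'Hom(quotv A, quotv B) :=
  linfun (fun q : quotv A => quotv_pi B (f (quotv_repr q))).

Hypothesis fAB : (f @: A <= B)%VS.

Lemma sub_lfunE x : vsval (sub_lfun x) = f (vsval x).
Proof.
rewrite lfunE /= vsprojK //.
by apply: (subvP fAB); rewrite memv_img ?subvsP.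
Qed.

Lemma quot_lfunE x : quot_lfun (quotv_pi A x) = quotv_pi B (f x).
Proof.
pose g (q : quotv A) := quotv_pi B (f (quotv_repr q)).
have gE y : g (quotv_pi A y) = quotv_pi B (f y).
  apply/eqP; rewrite quotv_pi_eq -linearB; apply: (subvP fAB).
  by rewrite memv_img // -quotv_pi_eq quotv_reprK.
have g_lin : linear g.
  move=> a p q; rewrite -(quotv_reprK p) -(quotv_reprK q) -linearP !gE.
  by rewrite linearP linearP.
pose gL := GRing.isSemilinear.Build K _ _ _ g (GRing.semilinear_linear g_lin).
pose G : {linear quotv A -> quotv B} := HB.pack g gL.
by rewrite -gE -[g]/(G : _ -> _) -(lfunE G).
Qed.

End InducedMaps.

Record quiver (n : nat) := Quiver {
  arrow : finType;
  src : arrow -> 'I_n;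
  tgt : arrow -> 'I_n
}.

Record representation (k : fieldType) (n : nat) (Q : quiver n) :=
  Representation {
    vsp : 'I_n -> vectType k;
    amap : forall a : arrow Q, 'Hom(vsp (src a), vsp (tgt a))
  }.

Section Representations.
Variables (k : fieldType) (n : nat) (Q : quiver n).
Implicit Types M : representation k Q.

Record rep_hom M M' := RepHom {
  hmap :> forall i, 'Hom(vsp M i, vsp M' i);
  hmap_comm : forall a : arrow Q,
    (hmap (tgt a) \o amap M a = amap M' a \o hmap (src a))%VF
}.

Definition rep_iso M M' : Prop :=
  exists f : rep_hom M M', forall i, bijective (f i).

Definition dimvec M : {ffun 'I_n -> nat} := [ffun i => \dim {: vsp M i}].

Definition nilpotent_lfun (V : vectType k) (f : 'End(V)) : Prop :=
  exists m : nat, forall v, iter m f v = 0.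

Definition nilpotent_endo M (e : rep_hom M M) : Prop :=
  forall i, nilpotent_lfun (e i).

Record subrep M := Subrep {
  ssp :> forall i, {vspace vsp M i};
  ssp_stable : forall a : arrow Q,
    (amap M a @: ssp (src a) <= ssp (tgt a))%VS
}.

Definition subrep_le M (N N' : subrep M) : bool :=
  [forall i, (N i <= N' i)%VS].

Definition rep_of_subrep M (N : subrep M) : representation k Q :=
  @Representation k n Q (fun i => subvs_of (N i))
    (fun a => sub_lfun (amap M a) (N (src a)) (N (tgt a))).

Definition quot_rep M (N : subrep M) : representation k Q :=
  @Representation k n Q (fun i => quotv (N i))
    (fun a => quot_lfun (amap M a) (N (src a)) (N (tgt a))).

Definition restr_space (V : vectType k) (A B : {vspace V}) :
    {vspace subvs_of A} := (linfun (@vsval k V A) @^-1: B)%VS.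

Lemma mem_restr_space (V : vectType k) (A B : {vspace V}) x :
  (x \in restr_space A B) = (vsval x \in B).
Proof. by rewrite -memv_preim lfunE. Qed.

Lemma restr_stable M (N N' : subrep M) (a : arrow Q) :
  (amap (rep_of_subrep N) a @: restr_space (N (src a)) (N' (src a))
     <= restr_space (N (tgt a)) (N' (tgt a)))%VS.
Proof.
apply/subvP => _ /memv_imgP[x xN ->]; rewrite mem_restr_space in xN.
rewrite mem_restr_space sub_lfunE; last exact: ssp_stable.
by apply: (subvP (ssp_stable N' a)); rewrite memv_img.
Qed.

Definition restr_subrep M (N N' : subrep M) : subrep (rep_of_subrep N) :=
  @Subrep (rep_of_subrep N) (fun i => restr_space (N i) (N' i))
    (restr_stable N N').

(* N / N' when N' <= N; in general N / (N :&: N'). *)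
Definition subquot M (N N' : subrep M) : representation k Q :=
  quot_rep (restr_subrep N N').

Definition is_filtration M (c : seq (subrep M)) : bool :=
  if c is N0 :: c' then
    [&& [forall i, N0 i == 0%VS], path (@subrep_le M) N0 c'
      & [forall i, last N0 c' i == fullv]]
  else false.

Definition endo_compatible M (e : rep_hom M M) (c : seq (subrep M)) : bool :=
  sorted (fun N N' : subrep M => [forall i, (e i @: N' i <= N i)%VS]) c.

(* N 0 0, then for i = 1, ..., r the terms N i r, N i (r-1), ..., N i i. *)
Definition chain_of M (N : nat -> nat -> subrep M) (r : nat) :
    seq (subrep M) :=
  N 0%N 0%N :: [seq N i s | i <- iota 1 r, s <- rev (iota i (r - i).+1)].

End Representations.

Record intpartition := IntPartition {
  parts :> seq nat;
  partsP : sorted geq parts && (0%N \notin parts)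
}.

Definition jordan_block (k : fieldType) (m : nat) : 'M[k]_m :=
  \matrix_(i, j) (val j == (val i).+1)%:R.

Definition jordan_mx (k : fieldType) (la : intpartition) :
    'M[k]_(\sum_(i < size la) nth 0 la i)%N :=
  \mxdiag_(i < size la) jordan_block k (nth 0%N la i).

(* f has type la: in some basis X, the matrix of f (acting on columns of
   coordinates) is block diagonal with nilpotent Jordan blocks of sizes the
   parts of la. *)
Definition has_type (k : fieldType) (V : vectType k) (f : 'End(V))
    (la : intpartition) : Prop :=
  exists2 X : (\sum_(i < size la) nth 0 la i)%N.-tuple V,
    basis_of fullv X &
    forall j : 'I_(\sum_(i < size la) nth 0 la i)%N,
      f X`_j = \sum_i jordan_mx k la i j *: X`_i.

Definition mult_vec (n : nat) (la : 'I_n -> intpartition) (s : nat) :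
    {ffun 'I_n -> nat} := [ffun i => count_mem s (la i)].

(* Equal to 0 when all the partitions are empty. *)
Definition largest_part (n : nat) (la : 'I_n -> intpartition) : nat :=
  (\max_(i < n) \max_(p <- la i) p)%N.

(* Main.v *)
(* Put N_{i,s} = (e^{i-1})^{-1} (ker e \cap im e^{s-1}) for i >= 1, so that
   N_{i,i} = ker e^i and e maps N_{i,s} into N_{i-1,i-1}. For i <= s, e^{i-1}
   maps N_{i,s} onto N_{1,s} with kernel N_{i-1,i-1}, hence induces all the
   required isomorphisms. In a Jordan basis dim im e^m is the sum over the parts
   p of max(p - m, 0), so by rank-nullity for e on im e^m the dimension of
   N_{1,s} = ker e \cap im e^{s-1} is the number of parts >= s. *)
From HB Require Import structures.
Require Import Defs.
From mathcomp Require Import all_boot all_order all_algebra.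

Set Implicit Arguments.
Unset Strict Implicit.
Unset Printing Implicit Defensive.

Import GRing.Theory.

Local Open Scope ring_scope.

(** * Powers of an endomorphism and the spaces N_{i,s} *)

Section LinearPower.
Variables (K : fieldType) (V : vectType K).
Implicit Types (f : 'End(V)) (m i s : nat).

(** Kept as a linear map rather than an iterated function, so that the kernels, images and preimages
    of powers are subspaces. *)
Definition lfun_exp f m : 'End(V) := iter m (comp_lfun f) \1%VF.

Lemma lfun_expE f m v : lfun_exp f m v = iter m f v.
Proof. by elim: m => [|m IHm]; rewrite /= ?id_lfunE // comp_lfunE IHm. Qed.

Lemma lfun_expS f m v : lfun_exp f m.+1 v = f (lfun_exp f m v).
Proof. exact: comp_lfunE. Qed.

Lemma lfun_expSr f m v : lfun_exp f m.+1 v = lfun_exp f m (f v).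
Proof. by rewrite !lfun_expE iterSr. Qed.

Lemma lfun_expD f m i v : lfun_exp f (m + i) v = lfun_exp f m (lfun_exp f i v).
Proof. by rewrite !lfun_expE iterD. Qed.

Lemma limg_expS f m : limg (lfun_exp f m.+1) = (f @: limg (lfun_exp f m))%VS.
Proof. exact: limg_comp. Qed.

Lemma limg_exp_anti f m s :
  (m <= s)%N -> (limg (lfun_exp f s) <= limg (lfun_exp f m))%VS.
Proof.
move/subnKC <-; apply/subvP => _ /memv_imgP[v _ ->].
by rewrite lfun_expD memv_img ?memvf.
Qed.

(* The space N_{i,s}, with N_{0,s} = 0. *)
Definition filt_space f i s : {vspace V} :=
  if i is i'.+1
  then (lfun_exp f i' @^-1: (lker f :&: limg (lfun_exp f s.-1)))%VS
  else 0%VS.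

Lemma mem_filt_space f i s v :
  (v \in filt_space f i.+1 s) =
    (lfun_exp f i.+1 v == 0) && (lfun_exp f i v \in limg (lfun_exp f s.-1)).
Proof. by rewrite -memv_preim memv_cap memv_ker lfun_expS. Qed.

Lemma filt_space_diag f i : filt_space f i i = lker (lfun_exp f i).
Proof.
case: i => [|i]; apply/vspaceP => v; rewrite memv_ker.
  by rewrite memv0 lfun_expE.
by rewrite mem_filt_space memv_img ?memvf ?andbT.
Qed.

Lemma filt_space_anti f i s : (filt_space f i s.+1 <= filt_space f i s)%VS.
Proof.
case: i => [|i]; first exact: subvv.
by rewrite lpreimS // capvS // limg_exp_anti ?leq_pred.
Qed.

Lemma lker_exp_sub_filt_space f i s :
  (lker (lfun_exp f i) <= filt_space f i.+1 s)%VS.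
Proof.
apply/subvP => v; rewrite memv_ker mem_filt_space lfun_expS => /eqP->.
by rewrite linear0 eqxx mem0v.
Qed.

Lemma limg_filt_space f i s :
  (f @: filt_space f i.+1 s <= lker (lfun_exp f i))%VS.
Proof.
apply/subvP => _ /memv_imgP[v + ->]; rewrite mem_filt_space memv_ker.
by rewrite -lfun_expSr => /andP[].
Qed.

Lemma filt_space1 f s :
  filt_space f 1 s = (lker f :&: limg (lfun_exp f s.-1))%VS.
Proof.
by apply/vspaceP => v; rewrite mem_filt_space memv_cap memv_ker !lfun_expE.
Qed.

Lemma mem_filt_space_shift f i s v :
  (v \in filt_space f i.+1 s) = (lfun_exp f i v \in filt_space f 1 s).
Proof. by rewrite filt_space1 -memv_preim. Qed.

(** The bound [i < s] gives im f^(s-1) inside im f^i, so the subspace pulled back along f^i lies in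
    the image of f^i and is recovered in full. *)
Lemma limg_exp_filt_space f i s :
  (i < s)%N -> (lfun_exp f i @: filt_space f i.+1 s = filt_space f 1 s)%VS.
Proof.
case: s => // s; rewrite ltnS => le_is.
rewrite lpreimK; last by rewrite (subv_trans (capvSr _ _)) ?limg_exp_anti.
by rewrite filt_space1.
Qed.

(** Rank-nullity for [f] restricted to im f^s. *)
Lemma dim_filt_space1 f s :
  (\dim (filt_space f 1 s.+1) + \dim (limg (lfun_exp f s.+1)) =
     \dim (limg (lfun_exp f s)))%N.
Proof. by rewrite filt_space1 capvC limg_expS limg_ker_dim. Qed.

End LinearPower.

Lemma lfun_exp_comm (K : fieldType) (U V : vectType K) (f : 'End(U))
    (g : 'End(V)) (a : 'Hom(U, V)) m :
  (g \o a = a \o f)%VF -> (lfun_exp g m \o a = a \o lfun_exp f m)%VF.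
Proof.
move=> ga; elim: m => [|m IHm] /=; first by rewrite comp_lfun1l comp_lfun1r.
by rewrite -comp_lfunA IHm !comp_lfunA ga.
Qed.

(** An intertwiner commutes with all powers, so it respects both the vanishing of a power and
    membership in the image of a power. Applied to the arrow maps, this makes the N_{i,s}
    subrepresentations. *)
Lemma filt_space_stable (K : fieldType) (U V : vectType K) (f : 'End(U))
    (g : 'End(V)) (a : 'Hom(U, V)) i s :
  (g \o a = a \o f)%VF -> (a @: filt_space f i s <= filt_space g i s)%VS.
Proof.
move=> ga; case: i => [|i]; first by rewrite limg0.
have gaE m v : lfun_exp g m (a v) = a (lfun_exp f m v).
  by rewrite -!comp_lfunE (lfun_exp_comm m ga).
apply/subvP => _ /memv_imgP[v + ->]; rewrite !mem_filt_space !gaE.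
move=> /andP[/eqP-> /memv_imgP[w _ ->]].
by rewrite linear0 eqxx -gaE memv_img ?memvf.
Qed.

(** * Ranks of powers computed in a Jordan basis *)

Section JordanBasis.
Variables (k : fieldType) (V : vectType k) (f : 'End(V)) (la : intpartition).

Notation sz b := (nth 0%N la b).
Notation idx := 'I_(\sum_(i < size la) sz i)%N.

Variable X : (\sum_(i < size la) sz i)%N.-tuple V.
Hypothesis X_basis : basis_of fullv X.
Hypothesis fX : forall j : idx, f X`_j = \sum_i jordan_mx k la i j *: X`_i.

(** A basis index is read as a box: its block and its position there, counted from 0. The map [f]
    lowers the position by one and kills position 0. *)
Let blk (j : idx) : 'I_(size la) := tagnat.sig1 j.
Let pos (j : idx) : nat := tagnat.sig2 j.

Let jordan_mxE (i j : idx) :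
  jordan_mx k la i j = ((blk i == blk j) && (pos j == (pos i).+1))%:R.
Proof.
(* The types of the positions depend on the blocks, so they are generalized before the two blocks
   are identified. *)
rewrite mxE /pos /blk; move: (tagnat.sig2 i) (tagnat.sig2 j).
case: eqVneq => [->|ne] p q; first by rewrite conform_mx_id mxE.
by rewrite mxE.
Qed.

Let idx_eqP (i j : idx) : blk i = blk j -> pos i = pos j -> i = j.
Proof.
move=> eb ep; apply: val_inj; apply/eqP.
rewrite -(tagnat.sig2K i) -(tagnat.sig2K j) tagnat.eq_Rank.
by apply/andP; split; apply/eqP.
Qed.

Let f_first (j : idx) : pos j = 0%N -> f X`_j = 0.
Proof.
by move=> pj; rewrite fX big1 // => i _; rewrite jordan_mxE pj andbF scale0r.
Qed.

Let f_next (i j : idx) : blk i = blk j -> pos j = (pos i).+1 -> f X`_j = X`_i.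
Proof.
move=> eb ep; rewrite fX (bigD1 i) //= {1}jordan_mxE ep eb !eqxx scale1r.
rewrite [X in _ + X]big1 ?addr0 // => i' ne; rewrite jordan_mxE ep.
case: eqP => [eb'|]; last by rewrite scale0r.
case: eqP => [[ep']|]; last by rewrite scale0r.
by case/eqP: ne; apply: idx_eqP; rewrite ?eb.
Qed.

Let idx_at (b : 'I_(size la)) t (lt_t : (t < sz b)%N) : idx :=
  @tagnat.Rank _ (fun b : 'I_(size la) => sz b) b (Ordinal lt_t).

Let blk_at (b : 'I_(size la)) t (lt_t : (t < sz b)%N) : blk (idx_at lt_t) = b.
Proof. exact: tagnat.Rank1K. Qed.

Let pos_at (b : 'I_(size la)) t (lt_t : (t < sz b)%N) : pos (idx_at lt_t) = t.
Proof. by rewrite /pos tagnat.Rank2K. Qed.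

Let pos_lt j : (pos j < sz (blk j))%N.
Proof. exact: ltn_ord. Qed.

Let exp_shift m (i j : idx) :
  blk i = blk j -> pos j = (m + pos i)%N -> lfun_exp f m X`_j = X`_i.
Proof.
elim: m i => [|m IHm] i eb ep.
  by rewrite lfun_expE (idx_eqP eb (esym ep)).
(* The induction hypothesis is used at the box just after [i], which exists because [pos j] is at
   least [(pos i).+1]. *)
have lt_i : ((pos i).+1 < sz (blk j))%N.
  by rewrite (leq_ltn_trans _ (pos_lt j)) // ep addSn ltnS leq_addl.
rewrite lfun_expS (IHm (idx_at lt_i)) ?blk_at ?pos_at ?addnS //.
by apply: f_next; rewrite ?blk_at ?pos_at.
Qed.

Let exp_small m (j : idx) : (pos j < m)%N -> lfun_exp f m X`_j = 0.
Proof.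
have lt_0 : (0 < sz (blk j))%N by apply: leq_ltn_trans (pos_lt j).
move/subnK <-; rewrite lfun_expD lfun_expS (@exp_shift _ (idx_at lt_0)).
- by rewrite f_first ?linear0 ?pos_at.
- by rewrite blk_at.
- by rewrite pos_at addn0.
Qed.

(** A basis vector survives in im f^m exactly when its block has a box [m] positions further on,
    whose vector f^m sends to it. *)
Let limg_expE m :
  limg (lfun_exp f m) =
    <<[seq X`_j | j : idx in [pred j : idx | (pos j + m < sz (blk j))%N]]>>%VS.
Proof.
rewrite -(span_basis X_basis) limg_span.
apply/subv_anti/andP; split; apply/span_subvP => v /mapP[].
  move=> _ /(nthP 0)[j lt_j <-] ->; rewrite size_tuple in lt_j.
  set j' : idx := Ordinal lt_j; rewrite -[X in X`_ _]/(val X) -[j]/(val j').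
  have [lt_jm|le_mj] := ltnP (pos j') m; first by rewrite exp_small ?mem0v.
  have lt_i : (pos j' - m < sz (blk j'))%N.
    by apply: leq_ltn_trans (leq_subr _ _) (pos_lt j').
  rewrite (@exp_shift _ (idx_at lt_i)) ?blk_at ?pos_at ?subnKC //.
  apply: memv_span; apply/mapP; exists (idx_at lt_i) => //.
  by rewrite mem_enum inE blk_at pos_at subnK.
move=> i; rewrite mem_enum inE => lt_i ->.
rewrite -(@exp_shift m i (idx_at lt_i)) ?blk_at ?pos_at 1?addnC //.
apply: memv_span; apply: map_f; apply: mem_nth; rewrite size_tuple.
exact: ltn_ord.
Qed.

(** The rank counts the surviving boxes: a block of size [p] keeps those at positions [t] with
    [t + m < p], which are [p - m] in number (0 when [p] is at most [m]). *)
Lemma jordan_dim_limg_exp m :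
  \dim (limg (lfun_exp f m)) = (\sum_(p <- la) (p - m))%N.
Proof.
have X_free := basis_free X_basis.
pose P (j : idx) := (pos j + m < sz (blk j))%N.
(* As a filter of [X], the spanning family inherits freeness from the basis, so the dimension
   becomes a count. *)
have -> : limg (lfun_exp f m) =
    <<[seq v <- X | [exists (j | P j), X`_j == v]]>>%VS.
  rewrite limg_expE; apply: eq_span => v; rewrite mem_filter.
  apply/mapP/andP => [[j]|[/exists_inP[j Pj /eqP<-] _]].
    rewrite mem_enum inE => Pj ->; split; first by apply/exists_inP; exists j.
    by rewrite mem_nth // size_tuple.
  by exists j => //; rewrite mem_enum inE.
rewrite (eqnP (filter_free _ X_free)) size_filter -sum1_count.
rewrite (big_nth 0) size_tuple big_mkord.
transitivity (\sum_(j : idx | P j) 1)%N.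
  apply: eq_bigl => j; apply/exists_inP/idP => [[i Pi]|Pj]; last by exists j.
  by rewrite nth_uniq ?size_tuple ?free_uniq // => /eqP /val_inj <-.
(* Flat indices are replaced by pairs of a block and a position, so that the count splits over the
   blocks. *)
rewrite (reindex _ (onW_bij _ (@tagnat.rank_bij _ _))) /=.
transitivity (\sum_(b < size la) \sum_(t < sz b | (t + m < sz b)%N) 1)%N.
  rewrite (@sig_big_dep _ _ _ _ (fun b : 'I_(size la) => 'I_(sz b)) xpredT
    (fun b t => (t + m < sz b)%N) (fun _ _ => 1%N)) /=.
  apply: eq_bigl => -[b t].
  by rewrite /P tagnat.rankE /= /pos tagnat.Rank2K /= /blk tagnat.Rank1K.
rewrite [RHS](big_nth 0%N) big_mkord; apply: eq_bigr => b _.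
rewrite -[RHS]card_ord -[RHS]sum1_card.
rewrite (@big_ord_widen _ _ _ _ (sz b) (fun=> 1%N)) ?leq_subr //.
by apply: eq_bigl => t; rewrite ltn_subRL addnC.
Qed.

End JordanBasis.

(** * Dimensions of the spaces N_{1,s} in terms of the type *)

Section JordanType.
Variables (k : fieldType) (V : vectType k) (f : 'End(V)) (la : intpartition).
Hypothesis f_la : has_type f la.

Lemma dim_limg_exp_type m :
  \dim (limg (lfun_exp f m)) = (\sum_(p <- la) (p - m))%N.
Proof. by have [X X_basis fX] := f_la; apply: jordan_dim_limg_exp fX m. Qed.

Lemma lker_exp_type m :
  (forall p, p \in (la : seq nat) -> p <= m)%N ->
  lker (lfun_exp f m) = fullv.
Proof.
move=> la_le; apply/eqP; rewrite eqEsubv subvf lkerE -dimv_eq0.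
rewrite dim_limg_exp_type.
by rewrite big_seq big1 // => p /la_le; rewrite -subn_eq0 => /eqP.
Qed.

Lemma dim_filt_space1_type s :
  \dim (filt_space f 1 s.+1) = (\sum_(p <- la) (s < p))%N.
Proof.
(* Adding the rank of f^(s+1) to both sides avoids a truncated difference; what remains is
   [p - s = (s < p) + (p - s.+1)] for each part. *)
apply: (@addIn (\sum_(p <- la) (p - s.+1))%N).
rewrite -dim_limg_exp_type dim_filt_space1 !dim_limg_exp_type -big_split /=.
by apply: eq_bigr => p _; rewrite subnS -subn_gt0; case: (p - s)%N.
Qed.

Lemma dim_filt_space1_step s :
  \dim (filt_space f 1 s.+1) =
    (\dim (filt_space f 1 s.+2) + count_mem s.+1 la)%N.
Proof.
rewrite !dim_filt_space1_type -sum1_count (big_mkcond (pred1 _)) -big_split /=.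
by apply: eq_bigr => p _ /=; case: (ltngtP s.+1 p).
Qed.

End JordanType.

(** * Linear bijections and dimensions of subspaces and quotients *)

Lemma lfun_bij (K : fieldType) (U V : vectType K) (f : 'Hom(U, V)) :
  lker f = 0%VS -> limg f = fullv -> bijective f.
Proof.
move=> kf0 imf; exists (f^-1)%VF; first by apply: lker0_lfunK; apply/eqP.
by move=> v; rewrite limg_lfunVK // imf memvf.
Qed.

Lemma dim_subvs (K : fieldType) (V : vectType K) (U : {vspace V}) :
  \dim {:subvs_of U} = \dim U.
Proof. by rewrite dimvf. Qed.

Lemma dim_quotv (K : fieldType) (V : vectType K) (U : {vspace V}) :
  \dim {:quotv U} = (\dim {:V} - \dim U)%N.
Proof. by rewrite dimvf -dimv_compl. Qed.

(** The injection [vsval] carries the restricted space onto the intersection. *)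
Lemma dim_restr_space (K : fieldType) (V : vectType K) (A B : {vspace V}) :
  \dim (restr_space A B) = \dim (A :&: B).
Proof.
have kf0 : lker (linfun (@vsval _ _ A)) = 0%VS.
  by apply/eqP/lker0P => u v; rewrite !lfunE /=; apply: subvs_inj.
rewrite -(@limg_dim_eq _ _ _ (linfun (@vsval _ _ A))) ?kf0 ?capv0 //.
congr (\dim _); apply/vspaceP => v; rewrite memv_cap.
apply/memv_imgP/andP => [[u + ->]|[Av Bv]]; rewrite ?mem_restr_space ?lfunE /=.
  by rewrite subvsP.
exists (vsproj A v); last by rewrite lfunE /= vsprojK.
by rewrite mem_restr_space vsprojK.
Qed.

(** * Factoring a linear map through a quotient *)

Section QuotientLift.
Variables (K : fieldType) (V W : vectType K) (f : 'Hom(V, W)) (U : {vspace V}).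

(* linfun is only meaningful here when f vanishes on U. *)
Definition quotv_lift : 'Hom(quotv U, W) := linfun (f \o @quotv_repr K V U).

Hypothesis f_U : (U <= lker f)%VS.

Lemma quotv_liftE x : quotv_lift (quotv_pi U x) = f x.
Proof.
have gE y : f (quotv_repr (quotv_pi U y)) = f y.
  apply/eqP; rewrite -subr_eq0 -linearB -memv_ker (subvP f_U) //.
  by rewrite -quotv_pi_eq quotv_reprK.
pose g := f \o @quotv_repr K V U.
have g_lin : linear g.
  move=> a p q; rewrite -(quotv_reprK p) -(quotv_reprK q) -linearP /g /= !gE.
  exact: linearP.
(* Linearity depends on [f_U], so the structure is packed locally; [lfunE] can then evaluate
   [linfun]. *)
pose gL := GRing.isSemilinear.Build K _ _ _ g (GRing.semilinear_linear g_lin).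
pose G : {linear quotv U -> W} := HB.pack g gL.
by rewrite /quotv_lift -/g -[g]/(G : _ -> _) lfunE /= /g /= gE.
Qed.

Lemma quotv_lift_bij : lker f = U -> limg f = fullv -> bijective quotv_lift.
Proof.
move=> kerf imf; apply: lfun_bij.
  apply/eqP/lker0P => p q.
  rewrite -(quotv_reprK p) -(quotv_reprK q) !quotv_liftE => /eqP.
  rewrite -subr_eq0 -linearB -memv_ker kerf -quotv_pi_eq => /eqP.
  by rewrite !quotv_reprK.
apply/eqP; rewrite eqEsubv subvf -imf; apply/subvP => _ /memv_imgP[v _ ->].
by rewrite -quotv_liftE memv_img ?memvf.
Qed.

End QuotientLift.

(** * Isomorphism theorems for representations *)

Section Isomorphisms.
Variables (k : fieldType) (n : nat) (Q : quiver n).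
Implicit Types M T : representation k Q.

Lemma rep_homE M M' (h : rep_hom M M') (a : arrow Q) v :
  h (tgt a) (amap M a v) = amap M' a (h (src a) v).
Proof. by rewrite -!comp_lfunE hmap_comm. Qed.

(** The lifts at the vertices are bijective, and they commute with the arrows because this can be
    checked on representatives of classes. *)
Lemma first_iso M M' (h : rep_hom M M') (N : subrep M) :
  (forall i, lker (h i) = N i) -> (forall i, limg (h i) = fullv) ->
  rep_iso (quot_rep N) M'.
Proof.
move=> kerh imh.
have h_N i : (N i <= lker (h i))%VS by rewrite kerh.
have comm (a : arrow Q) :
    (quotv_lift (h (tgt a)) (N (tgt a)) \o amap (quot_rep N) a =
     amap M' a \o quotv_lift (h (src a)) (N (src a)))%VF.
  apply/lfunP => q; rewrite !comp_lfunE -(quotv_reprK q) /=.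
  by rewrite quot_lfunE ?ssp_stable // !quotv_liftE // rep_homE.
exists (@RepHom _ _ _ (quot_rep N) M' (fun i => quotv_lift (h i) (N i)) comm).
by move=> i; apply: quotv_lift_bij.
Qed.

Lemma subrep_amap_vsval M (N : subrep M) (a : arrow Q) x :
  vsval (amap (rep_of_subrep N) a x) = amap M a (vsval x).
Proof. by rewrite sub_lfunE ?ssp_stable. Qed.

Section Restriction.
Variables (M T : representation k Q) (h : rep_hom M T).
Variables (N : subrep M) (P : subrep T).
Hypothesis h_NP : forall i, (h i @: N i = P i)%VS.

Let h_sub i : (h i @: N i <= P i)%VS.
Proof. by rewrite h_NP. Qed.

Fact restr_hom_comm (a : arrow Q) :
  (sub_lfun (h (tgt a)) (N (tgt a)) (P (tgt a)) \o amap (rep_of_subrep N) a =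
   amap (rep_of_subrep P) a \o sub_lfun (h (src a)) (N (src a)) (P (src a)))%VF.
Proof.
apply/lfunP => x; apply: subvs_inj.
rewrite comp_lfunE (sub_lfunE (h_sub _)) comp_lfunE !subrep_amap_vsval.
by rewrite (sub_lfunE (h_sub _)) rep_homE.
Qed.

Definition restr_hom : rep_hom (rep_of_subrep N) (rep_of_subrep P) :=
  @RepHom _ _ _ (rep_of_subrep N) (rep_of_subrep P)
    (fun i => sub_lfun (h i) (N i) (P i)) restr_hom_comm.

Lemma restr_homE i x : vsval (restr_hom i x) = h i (vsval x).
Proof. exact: sub_lfunE. Qed.

Lemma limg_restr_hom i : limg (restr_hom i) = fullv.
Proof.
apply/eqP; rewrite eqEsubv subvf; apply/subvP => y _; apply/memv_imgP.
have /memv_imgP[x Nx yE] : vsval y \in (h i @: N i)%VS by rewrite h_NP subvsP.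
exists (vsproj (N i) x); rewrite ?memvf //; apply: subvs_inj.
by rewrite restr_homE vsprojK.
Qed.

(** The hypothesis says that [N'] meets [N] in the kernel of the surjection from [N] to [P] induced
    by [h]. *)
Lemma subquot_iso_subrep (N' : subrep M) :
  (forall i v, v \in N i -> (v \in N' i) = (h i v == 0)) ->
  rep_iso (subquot N N') (rep_of_subrep P).
Proof.
move=> N'E; apply: (first_iso (h := restr_hom)); last exact: limg_restr_hom.
move=> i; apply/vspaceP => x; rewrite memv_ker mem_restr_space N'E ?subvsP //.
by rewrite -restr_homE -(inj_eq subvs_inj).
Qed.

Lemma subquot_iso (N' : subrep M) (P' : subrep T) :
  (forall i v, v \in N i -> (v \in N' i) = (h i v \in P' i)) ->
  rep_iso (subquot N N') (subquot P P').
Proof.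
move=> N'E.
(* The composite of [N] onto [P] with [P] onto its quotient by [P'] is surjective, and its kernel is
   the part of [N] lying in [N']. *)
pose g i : 'Hom(subvs_of (N i), quotv (restr_space (P i) (P' i))) :=
  (linfun (quotv_pi (restr_space (P i) (P' i))) \o restr_hom i)%VF.
have gE i x : g i x = quotv_pi (restr_space (P i) (P' i)) (restr_hom i x).
  by rewrite comp_lfunE lfunE.
have g_comm (a : arrow Q) :
    (g (tgt a) \o amap (rep_of_subrep N) a =
     amap (subquot P P') a \o g (src a))%VF.
  apply/lfunP => x; rewrite [LHS]comp_lfunE [RHS]comp_lfunE !gE.
  rewrite [RHS]quot_lfunE ?restr_stable //; congr (quotv_pi _ _).
  exact: rep_homE restr_hom a x.
pose G := @RepHom _ _ _ (rep_of_subrep N) (subquot P P') g g_comm.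
apply: (first_iso (h := G)).
  move=> i; apply/vspaceP => x.
  rewrite memv_ker mem_restr_space N'E ?subvsP //= gE.
  rewrite -(linear0 (quotv_pi _)) quotv_pi_eq subr0.
  by rewrite mem_restr_space restr_homE.
move=> i; rewrite limg_comp limg_restr_hom.
apply/eqP; rewrite eqEsubv subvf; apply/subvP => q _; apply/memv_imgP.
by exists (quotv_repr q); rewrite ?memvf // lfunE /= quotv_reprK.
Qed.

End Restriction.

Lemma dim_subquot M (N N' : subrep M) i :
  dimvec (subquot N N') i = (\dim (N i) - \dim (N i :&: N' i))%N.
Proof. by rewrite ffunE dim_quotv dim_subvs dim_restr_space. Qed.

End Isomorphisms.

(** * Consecutive terms and last term of the chain *)

Section Chain.
Variables (T : Type) (N : nat -> nat -> T) (r : nat).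

(** [row i m] is the tail of length [m] of row [i], ending at [N i i]; [rows i m] joins [m] complete
    rows. Free lengths allow induction. *)
Let row i m : seq T := [seq N i s | s <- rev (iota i m)].
Let rows i m : seq T :=
  [seq N j s | j <- iota i m, s <- rev (iota j (r - j).+1)].

Let rowS i m : row i m.+1 = N i (i + m) :: row i m.
Proof. by rewrite /row -addn1 iotaD cats1 rev_rcons. Qed.

Let row_last i m : last (N i (i + m)) (row i m) = N i i.
Proof.
by case: m => [|m]; rewrite /row ?addn0 //= rev_cons map_rcons last_rcons.
Qed.

Let rowsS i m : (i <= r)%N ->
  rows i m.+1 = N i r :: row i (r - i) ++ rows i.+1 m.
Proof.
by move=> le_ir; rewrite -[LHS]/(row i (r - i).+1 ++ _) rowS subnKC.
Qed.

Lemma chain_last :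
  last (N 0%N 0%N) [seq N i s | i <- iota 1 r, s <- rev (iota i (r - i).+1)]
    = N r r.
Proof.
(* Induction on the number [m] of rows still to come, after the end [N i i] of the previous row. *)
suff rows_last i m : (i + m)%N = r -> last (N i i) (rows i.+1 m) = N r r.
  exact: rows_last.
elim: m i => [|m IHm] i im; first by rewrite /= -im addn0.
have lt_ir : (i < r)%N by rewrite -im addnS ltnS leq_addr.
have := row_last i.+1 (r - i.+1).
rewrite rowsS //= last_cat subnKC // => ->.
by rewrite IHm // addSnnS.
Qed.

Variable R : rel T.
Hypothesis R_first : forall i, (i < r)%N -> R (N i i) (N i.+1 r).
Hypothesis R_step : forall i s, (i < s < r)%N -> R (N i.+1 s.+1) (N i.+1 s).

Let row_path i m : (i.+1 + m <= r)%N -> path R (N i.+1 (i.+1 + m)) (row i.+1 m).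
Proof.
elim: m => // m IHm; rewrite addnS => le_r.
by rewrite rowS /= R_step ?IHm ?(ltnW le_r) //= ?leq_addr.
Qed.

(** The relation is arbitrary because both inclusion and e-compatibility are checked along the
    chain. Neighbours are either in one row or at the passage from [N i i] to the next row. *)
Lemma chain_path :
  path R (N 0%N 0%N) [seq N i s | i <- iota 1 r, s <- rev (iota i (r - i).+1)].
Proof.
suff rows_path i m : (i + m)%N = r -> path R (N i i) (rows i.+1 m).
  exact: rows_path.
elim: m i => // m IHm i im.
have lt_ir : (i < r)%N by rewrite -im addnS ltnS leq_addr.
have := row_last i.+1 (r - i.+1); have := @row_path i (r - i.+1).
rewrite rowsS //= cat_path subnKC // => -> // ->.
by rewrite R_first // IHm // addSnnS.
Qed.

End Chain.

(** * The filtration of the representation and its subquotients *)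

Section Filtration.
Variables (k : fieldType) (n : nat) (Q : quiver n) (M : representation k Q).
Variable e : rep_hom M M.

Definition filt_subrep (i s : nat) : subrep M :=
  @Subrep _ _ _ M (fun j => filt_space (e j) i s)
    (fun a => filt_space_stable i s (hmap_comm e a)).

Fact rep_exp_comm m (a : arrow Q) :
  (lfun_exp (e (tgt a)) m \o amap M a = amap M a \o lfun_exp (e (src a)) m)%VF.
Proof. exact/lfun_exp_comm/hmap_comm. Qed.

Definition rep_exp m : rep_hom M M :=
  @RepHom _ _ _ M M (fun j => lfun_exp (e j) m) (rep_exp_comm m).

Lemma filt_subrep_first i s : subrep_le (filt_subrep i i) (filt_subrep i.+1 s).
Proof.
by apply/forallP => j /=; rewrite filt_space_diag lker_exp_sub_filt_space.
Qed.

Lemma filt_subrep_step i s : subrep_le (filt_subrep i s.+1) (filt_subrep i s).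
Proof. by apply/forallP => j; apply: filt_space_anti. Qed.

(** The image lies in ker e^i, which every space of row [i.+1] contains; hence [s] and [s'] are
    unrelated. *)
Lemma filt_subrep_compat i s s' j :
  (e j @: filt_subrep i.+1 s j <= filt_subrep i.+1 s' j)%VS.
Proof.
exact: subv_trans (limg_filt_space _ _ _) (lker_exp_sub_filt_space _ _ _).
Qed.

(** The power e^i maps N_{i+1,s} onto N_{1,s}, and N_{i+1,s+1} is the full preimage of N_{1,s+1}. *)
Lemma filt_subquot_iso i s :
  (i < s)%N ->
  rep_iso (subquot (filt_subrep i.+1 s) (filt_subrep i.+1 s.+1))
          (subquot (filt_subrep 1 s) (filt_subrep 1 s.+1)).
Proof.
move=> lt_is; apply: (@subquot_iso _ _ _ _ _ (rep_exp i)) => [j|j v _].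
  exact: limg_exp_filt_space.
exact: mem_filt_space_shift.
Qed.

Lemma filt_subquot_iso_subrep i s :
  (i < s)%N ->
  rep_iso (subquot (filt_subrep i.+1 s) (filt_subrep i i))
          (rep_of_subrep (filt_subrep 1 s)).
Proof.
move=> lt_is; apply: (@subquot_iso_subrep _ _ _ _ _ (rep_exp i)) => [j|j v _].
  exact: limg_exp_filt_space.
by rewrite /= filt_space_diag memv_ker.
Qed.

Variable la : 'I_n -> intpartition.
Hypothesis e_la : forall i, has_type (e i) (la i).

Lemma leq_largest_part j p : p \in (la j : seq nat) -> (p <= largest_part la)%N.
Proof.
move=> la_p; rewrite /largest_part (bigD1 j) //= leq_max; apply/orP; left.
by rewrite (big_rem p la_p) leq_maxl.
Qed.

Lemma filt_subrep_top j :
  filt_subrep (largest_part la) (largest_part la) j = fullv.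
Proof.
rewrite /= filt_space_diag (lker_exp_type (e_la j)) // => p.
exact: leq_largest_part.
Qed.

Lemma dim_filt_subquot s :
  dimvec (subquot (filt_subrep 1 s.+1) (filt_subrep 1 s.+2)) = mult_vec la s.+1.
Proof.
apply/ffunP => j; rewrite dim_subquot [RHS]ffunE.
rewrite (capv_idPr (filt_space_anti _ _ _)).
by rewrite /= (dim_filt_space1_step (e_la j)) addKn.
Qed.

(** No part exceeds the largest one, so N_{1,r+1} has dimension 0 and only the multiplicity of r
    remains. *)
Lemma dim_filt_top s :
  largest_part la = s.+1 ->
  dimvec (rep_of_subrep (filt_subrep 1 s.+1)) = mult_vec la s.+1.
Proof.
move=> r_s; apply/ffunP => j; rewrite [LHS]ffunE [RHS]ffunE dim_subvs /=.
rewrite (dim_filt_space1_step (e_la j)) (dim_filt_space1_type (e_la j)).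
rewrite big_seq big1 // => p /leq_largest_part; rewrite r_s.
by rewrite leqNgt => /negPf->.
Qed.

End Filtration.

Local Close Scope ring_scope.

Theorem theorem2p2 (k : fieldType) (n : nat) (Q : quiver n)
    (M : representation k Q) (e : rep_hom M M) (he : nilpotent_endo e)
    (la : 'I_n -> intpartition) (hla : forall i, has_type (e i) (la i)) :
  let r := largest_part la in
  exists N : nat -> nat -> subrep M,
    [/\ [/\ forall j, N 0 0 j = 0%VS,
            forall j, N r r j = fullv,
            forall i, 1 <= i <= r -> subrep_le (N i.-1 i.-1) (N i r)
          & forall i s, 1 <= i -> i <= s < r ->
              subrep_le (N i s.+1) (N i s)],
        is_filtration (chain_of N r) /\ endo_compatible e (chain_of N r),
        forall i s, 1 <= i <= r -> i <= s <= r - 1 ->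
          rep_iso (subquot (N i s) (N i s.+1)) (subquot (N 1 s) (N 1 s.+1))
          /\ dimvec (subquot (N 1 s) (N 1 s.+1)) = mult_vec la s
      & forall i, 1 <= i <= r ->
          rep_iso (subquot (N i r) (N i.-1 i.-1)) (rep_of_subrep (N 1 r))
          /\ dimvec (rep_of_subrep (N 1 r)) = mult_vec la r].
Proof.
move=> r; exists (filt_subrep e); split.
- split=> [//|||i s _ _]; last exact: filt_subrep_step.
    exact: filt_subrep_top.
  by case=> // i _; apply: filt_subrep_first.
- split.
    apply/and3P; split; first by apply/forallP => j.
      apply: chain_path => [i _|i s _]; first exact: filt_subrep_first.
      exact: filt_subrep_step.
    by apply/forallP => j; rewrite chain_last filt_subrep_top.
  apply: chain_path => [i _|i s _]; apply/forallP => j.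
    (* Between rows, [e] sends N_{i+1,r} into ker e^i, which is N_{i,i}. *)
    by rewrite [X in (_ <= X)%VS]/= filt_space_diag limg_filt_space.
  exact: filt_subrep_compat.
- move=> [|i] [|s] // _ /andP[lt_is _]; split; first exact: filt_subquot_iso.
  exact: dim_filt_subquot.
move=> [|i] // /andP[_ lt_ir]; split; first exact: filt_subquot_iso_subrep.
(* The bounds on [i] exclude r = 0, which gives the successor form that [dim_filt_top] expects. *)
case r_s: r lt_ir => [|s] // _.
exact: dim_filt_top.
Qed.
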